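(* Let $R$ be an ordered ring that is not a division ring. Then: (i) there exist positive integers $m,n$ and data $A\in R^{m\times n}$, $\vec b\in R^m$, $\vec c\in R^n$ such that the associated primal program is infeasible, while the associated dual program is neither infeasible nor unbounded; and (ii) there exist positive integers $m,n$ and data $A\in R^{m\times n}$, $\vec b\in R^m$, $\vec c\in R^n$ such that the associated dual program is infeasible, while the associated primal program is neither infeasible nor unbounded.
   Context: Rings are associative with identity $1$, not necessarily commutative. A ring $R$ is ordered if there is a non-empty subset $P\subset R$ (the positives) such that: (1) $R$ is the disjoint union $P\sqcup\{0\}\sqcup -P$; (2) $a,b\in P$ implies $a+b\in P$; (3) $a,b\in P$ implies $ab\in P$. Write $a>b$ if $a-b\in P$, and $a\ge b$ if $a-b\in P\cup\{0\}$. Inequalities between vectors are entrywise. Given $A\in R^{m\times n}$, $\vec b\in R^m$, $\vec c\in R^n$, the primal program is: find $\vec x\in R^n$ with $A\vec x\le \vec b$ and $\vec x\ge 0$ (such $\vec x$ are called feasible) maximizing $f(\vec x)=\vec c^{\,T}\vec x$. The dual program is: find $\vec y\in R^m$ with $\vec y^{\,T}A\ge \vec c^{\,T}$ and $\vec y\ge 0$ (such $\vec y$ are called feasible) minimizing $g(\vec y)=\vec y^{\,T}\vec b$. A program is infeasible if it has no feasible vector. The primal program is unbounded if it is feasible and for every $r\in R$ there is a feasible $\vec x$ with $f(\vec x)>r$; the dual program is unbounded if it is feasible and for every $r\in R$ there is a feasible $\vec y$ with $g(\vec y)<r$. *)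

(* Defs.v *)
From mathcomp Require Import all_boot all_algebra.
Set Implicit Arguments.
Unset Strict Implicit.
Unset Printing Implicit Defensive.
Import GRing.Theory.
Local Open Scope ring_scope.

(* MathComp's ordered rings ([numDomainType] and below) are commutative, so the
   order on a possibly noncommutative ring is given here by its set of
   positives.  Since that set is nonempty and omits 0, the ring is nontrivial. *)
Record positives (R : pzRingType) (P : R -> Prop) : Prop := Positives {
  pos_nonempty : exists a, P a;
  pos_cover : forall a, [\/ P a, a = 0 | P (- a)];
  pos_not0 : ~ P 0;
  pos_disjoint : forall a, ~ (P a /\ P (- a));
  pos_add : forall a b, P a -> P b -> P (a + b);
  pos_mul : forall a b, P a -> P b -> P (a * b)
}.

Definition division_ring (R : pzRingType) : Prop :=
  (1 : R) <> 0 /\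
  forall a : R, a <> 0 -> exists b : R, a * b = 1 /\ b * a = 1.

Section LinearProgram.

Variables (R : pzRingType) (P : R -> Prop).

Definition ogt (a b : R) : Prop := P (a - b).
Definition oge (a b : R) : Prop := P (a - b) \/ a - b = 0.

Definition mxge m n (U V : 'M[R]_(m, n)) : Prop :=
  forall i j, oge (U i j) (V i j).

Variables (m n : nat) (A : 'M[R]_(m, n)) (b : 'cV[R]_m) (c : 'cV[R]_n).

Definition primal_feasible (x : 'cV[R]_n) : Prop :=
  mxge b (A *m x) /\ mxge x 0.

Definition primal_obj (x : 'cV[R]_n) : R := (c^T *m x) 0 0.

Definition dual_feasible (y : 'cV[R]_m) : Prop :=
  mxge (y^T *m A) c^T /\ mxge y 0.

Definition dual_obj (y : 'cV[R]_m) : R := (y^T *m b) 0 0.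

Definition primal_infeasible : Prop := ~ exists x, primal_feasible x.

Definition dual_infeasible : Prop := ~ exists y, dual_feasible y.

Definition primal_unbounded : Prop :=
  (exists x, primal_feasible x) /\
  forall r, exists x, primal_feasible x /\ ogt (primal_obj x) r.

Definition dual_unbounded : Prop :=
  (exists y, dual_feasible y) /\
  forall r, exists y, dual_feasible y /\ ogt r (dual_obj y).

End LinearProgram.

(* Main.v *)
(** A non-division ordered ring contains a positive [a] without a one-sided
    inverse: there are no zero divisors, so one-sided inverses are two-sided.
    The inequalities [a x <= 1] and [- a x <= - 1] force [a x = 1], hence are
    infeasible.  With zero objective, the dual asks to minimise [t = y1 - y2]
    subject to [t a >= 0]; as [a > 0], this forces [t >= 0], and the minimum 0
    is attained.  The second part is the transpose of this example. *)
Require Import Defs.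
From mathcomp Require Import all_boot all_algebra.
From Stdlib Require Import Classical.
Import GRing.Theory.
Local Open Scope ring_scope.

Set Implicit Arguments.
Unset Strict Implicit.

Section OrderedRing.

Variables (R : pzRingType) (P : R -> Prop).
Hypothesis hP : positives P.

Lemma oge_refl (a : R) : oge P a a.
Proof. by right; rewrite subrr. Qed.

Lemma ogt_asym (a b : R) : ogt P a b -> ~ ogt P b a.
Proof.
by rewrite /ogt -(opprB a b) => hab hba; apply: (pos_disjoint hP (conj hab hba)).
Qed.

Lemma oge_antisym (a b : R) : oge P a b -> oge P b a -> a = b.
Proof.
move=> [hab|/eqP]; last by rewrite subr_eq0 => /eqP.
move=> [hba|/eqP]; last by rewrite subr_eq0 => /eqP.
by case: (ogt_asym hab hba).
Qed.

Lemma oge_not_ogt (a b : R) : oge P a b -> ~ ogt P b a.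
Proof.
case=> [|/eqP]; first exact: ogt_asym.
by rewrite subr_eq0 /ogt => /eqP ->; rewrite subrr; apply: (pos_not0 hP).
Qed.

Lemma oge_opp (a b : R) : oge P (- a) (- b) <-> oge P b a.
Proof. by rewrite /oge opprK addrC. Qed.

Lemma oppr_oge0 (a : R) : oge P (- a) 0 <-> oge P 0 a.
Proof. by rewrite /oge subr0 sub0r. Qed.

Lemma oppr_mul_not_oge0 (a b : R) : P a -> P b -> ~ oge P (- (a * b)) 0.
Proof.
move=> ha hb /oppr_oge0 /oge_not_ogt; apply; rewrite /ogt subr0.
exact: pos_mul.
Qed.

(** Were [- t] positive, [(- t) * a = - (t * a)] would be too, against the hypothesis; trichotomy
    leaves the other two cases. Without commutativity each side needs its own version. *)
Lemma oge0_mulIr (a t : R) : P a -> oge P (t * a) 0 -> oge P t 0.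
Proof.
move=> ha hta; case: (pos_cover hP t) => [ht|->|hNt].
- by left; rewrite subr0.
- exact: oge_refl.
by case: (oppr_mul_not_oge0 hNt ha); rewrite mulNr opprK.
Qed.

Lemma oge0_mulIl (a t : R) : P a -> oge P (a * t) 0 -> oge P t 0.
Proof.
move=> ha hat; case: (pos_cover hP t) => [ht|->|hNt].
- by left; rewrite subr0.
- exact: oge_refl.
by case: (oppr_mul_not_oge0 ha hNt); rewrite mulrN opprK.
Qed.

(** Cancelling [a] from the inequality for [t] and for [- t] bounds [t] on both sides by 0. *)
Lemma pos_mulrI0 (a t : R) : P a -> a * t = 0 -> t = 0.
Proof.
move=> ha e; apply: oge_antisym; last apply/oppr_oge0.
  by apply: (oge0_mulIl ha); rewrite e; apply: oge_refl.
by apply: (oge0_mulIl ha); rewrite mulrN e oppr0; apply: oge_refl.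
Qed.

Lemma pos_mulIr0 (a t : R) : P a -> t * a = 0 -> t = 0.
Proof.
move=> ha e; apply: oge_antisym; last apply/oppr_oge0.
  by apply: (oge0_mulIr ha); rewrite e; apply: oge_refl.
by apply: (oge0_mulIr ha); rewrite mulNr e oppr0; apply: oge_refl.
Qed.

(** If [a * b = 1], then [a * (b * a - 1) = (a * b) * a - a = 0], and [a] cancels; the converse
    cancels on the right. *)
Lemma pos_mul_eq1C (a b : R) : P a -> a * b = 1 <-> b * a = 1.
Proof.
move=> ha; split=> e; apply/eqP; rewrite -subr_eq0; apply/eqP.
  by apply: (pos_mulrI0 ha); rewrite mulrBr mulrA e mul1r mulr1 subrr.
by apply: (pos_mulIr0 ha); rewrite mulrBl -mulrA e mul1r mulr1 subrr.
Qed.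

Lemma oner_neq0_of_positives : (1 : R) <> 0.
Proof.
move=> e; case: (pos_nonempty hP) => a ha; apply: (pos_not0 hP).
by rewrite -[a]mul1r e mul0r in ha.
Qed.

Lemma pos_noninvertible : ~ division_ring R ->
  exists a : R, [/\ P a, forall b, a * b <> 1 & forall b, b * a <> 1].
Proof.
move=> hR; apply: NNPP => hN; apply: hR; split; first exact: oner_neq0_of_positives.
have inv a : P a -> exists b, a * b = 1 /\ b * a = 1.
  move=> ha; apply: NNPP => hb; apply: hN; exists a; split=> // b e; apply: hb.
    by exists b; split=> //; apply/(pos_mul_eq1C b ha).
  by exists b; split=> //; apply/(pos_mul_eq1C b ha).
(* Inverses of positives suffice: if [b] inverts [- a], then [- b] inverts [a]. *)
move=> a a0; case: (pos_cover hP a) => // [/inv //|/inv [b [e1 e2]]].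
by exists (- b); rewrite mulrN -mulNr e1 mulNr -mulrN e2.
Qed.

(** Opposite entries make an entrywise inequality between two such columns an equation, and make the
    product with a vector depend only on the difference of its coordinates. *)
Definition pm_col (a : R) : 'cV[R]_2 := \col_i (if i == 0 then a else - a).

Lemma mxge_pm_col (a b : R) :
  mxge P (pm_col a) (pm_col b) -> a = b.
Proof.
move=> h; apply: oge_antisym; first by have := h 0 0; rewrite !mxE.
by have := h 1 0; rewrite !mxE /= oge_opp.
Qed.

Lemma pm_col_mul (a : R) (x : 'cV[R]_1) : pm_col a *m x = pm_col (a * x 0 0).
Proof.
by apply/matrixP=> i j; rewrite !mxE big_ord1 !mxE (ord1 j); case: ifP; rewrite ?mulNr.
Qed.

Lemma mul_tr_pm_col (a : R) (y : 'cV[R]_1) :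
  y^T *m (pm_col a)^T = (pm_col (y 0 0 * a))^T.
Proof.
by apply/matrixP=> i j; rewrite !mxE big_ord1 !mxE (ord1 i); case: ifP; rewrite ?mulrN.
Qed.

Lemma dot_pm_col (a : R) (y : 'cV[R]_2) :
  (y^T *m pm_col a) 0 0 = (y 0 0 - y 1 0) * a.
Proof.
rewrite !mxE !big_ord_recl big_ord0 !mxE /= addr0 mulrN mulrBl.
(* The second index comes out of [big_ord_recl] as a lift, which agrees with [1] by value. *)
by congr (_ - y _ _ * _); apply: val_inj.
Qed.

Lemma pm_col_dot (a : R) (x : 'cV[R]_2) :
  ((pm_col a)^T *m x) 0 0 = a * (x 0 0 - x 1 0).
Proof.
rewrite !mxE !big_ord_recl big_ord0 !mxE /= addr0 mulNr mulrBr.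
by congr (_ - _ * x _ _); apply: val_inj.
Qed.

End OrderedRing.

Unset Implicit Arguments.
Set Strict Implicit.

Theorem theorem3p9 (R : pzRingType) (P : R -> Prop)
    (hP : positives P) (hR : ~ division_ring R) :
  (exists m n : nat, (0 < m)%N /\ (0 < n)%N /\
     exists (A : 'M[R]_(m, n)) (b : 'cV[R]_m) (c : 'cV[R]_n),
       primal_infeasible P A b /\
       ~ dual_infeasible P A c /\ ~ dual_unbounded P A b c) /\
  (exists m n : nat, (0 < m)%N /\ (0 < n)%N /\
     exists (A : 'M[R]_(m, n)) (b : 'cV[R]_m) (c : 'cV[R]_n),
       dual_infeasible P A c /\
       ~ primal_infeasible P A b /\ ~ primal_unbounded P A b c).
Proof.
have [a [ha har hal]] := pos_noninvertible hP hR.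
split.
- exists 2%N, 1%N; do 2![split=> //].
  exists (pm_col a), (pm_col 1), 0; split; [|split].
  + by case=> x [+ _]; rewrite pm_col_mul => /(mxge_pm_col hP) /esym /har.
  + apply; exists 0; split=> [|i j]; last exact: oge_refl.
    by rewrite !trmx0 mul0mx => i j; apply: oge_refl.
  (* Test unboundedness at [r = 0]: with [t = y 0 0 - y 1 0], feasibility gives [t * a >= 0],
     whereas the objective [t] would be negative. *)
  + case=> _ /(_ 0) [y [[/(_ 0 0) + _]]].
    rewrite /dual_obj !dot_pm_col mulr1 !mxE => /(oge0_mulIr hP ha).
    exact: oge_not_ogt.
- exists 1%N, 2%N; do 2![split=> //].
  exists (pm_col a)^T, 0, (pm_col 1); split; [|split].
  (* The transposed constraint forces [y 0 0 * a = 1], so here it is the absence of a left inverse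
     that matters. *)
  + case=> y [hy _]; apply: (hal (y 0 0)); apply: (mxge_pm_col hP) => i j.
    by have := hy j i; rewrite mul_tr_pm_col !mxE.
  + apply; exists 0; split=> [|i j]; last exact: oge_refl.
    by rewrite mulmx0 => i j; apply: oge_refl.
  + case=> _ /(_ 0) [x [[/(_ 0 0) + _]]].
    rewrite /primal_obj !pm_col_dot mul1r mxE => /oppr_oge0; rewrite -mulrN.
    (* The constraint is [a * t <= 0] with [t = x 0 0 - x 1 0]; cancelling [a] for [- t] contradicts
       a positive objective [t]. *)
    by move=> /(oge0_mulIl hP ha) /oppr_oge0; apply: oge_not_ogt.
Qed.
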